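(* Let $(B,\lfloor\cdot,\cdot\rfloor)$ be an SSD space, $E:\mathbb{R}_+\rightrightarrows B$ a multifunction with graph $G(E)$, and define $\Psi:\mathbb{R}\times B\to\mathbb{R}\times B$ by $\Psi(\epsilon,b)=(\epsilon+q(b),b)$ for all $(\epsilon,b)\in\mathbb{R}\times B$. The following statements are equivalent: (i) $E$ satisfies the transportation formula; (ii) $E$ satisfies the generalized transportation formula (or $n$-point transportation formula), that is, for all $n\geq 1$, $\varepsilon_i\geq 0$, $b^i\in E(\varepsilon_i)$ and $\alpha_i\geq 0$, $i=1,\dots,n$, with $\sum_{i=1}^n\alpha_i=1$, one has $\varepsilon:=\sum_{i=1}^n\alpha_i\varepsilon_i+\sum_{i=1}^n\alpha_i q\big(b^i-\sum_{j=1}^n\alpha_jb^j\big)\geq 0$ and $\sum_{i=1}^n\alpha_ib^i\in E(\varepsilon)$; (iii) $\Psi(G(E))$ is convex.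
   Context: A symmetrically self-dual space (SSD space) is a pair $(B,\lfloor\cdot,\cdot\rfloor)$ where $B$ is a nonzero real vector space and $\lfloor\cdot,\cdot\rfloor:B\times B\to\mathbb{R}$ is a symmetric bilinear form. Put $q:B\to\mathbb{R}$, $q(b)=\frac12\lfloor b,b\rfloor$. $\mathbb{R}_+=[0,+\infty)$. The graph of $E:\mathbb{R}_+\rightrightarrows B$ is $G(E)=\{(\varepsilon,b)\in\mathbb{R}_+\times B: b\in E(\varepsilon)\}$. A multifunction $E:\mathbb{R}_+\rightrightarrows B$ satisfies the transportation formula if for all $\varepsilon_1,\varepsilon_2\geq 0$, $b^1\in E(\varepsilon_1)$, $b^2\in E(\varepsilon_2)$ and all $\alpha_1,\alpha_2\geq 0$ with $\alpha_1+\alpha_2=1$ one has $\varepsilon:=\alpha_1\varepsilon_1+\alpha_2\varepsilon_2+\alpha_1\alpha_2 q(b^1-b^2)\geq 0$ and $\alpha_1b^1+\alpha_2b^2\in E(\varepsilon)$. *)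

(* Defs.v *)
From HB Require Import structures.
From mathcomp Require Export all_boot all_order all_algebra.
From mathcomp Require Export classical_sets reals interval_inference convex.

Set Implicit Arguments.
Unset Strict Implicit.
Unset Printing Implicit Defensive.

Import Order.TTheory GRing.Theory Num.Theory.

Local Open Scope classical_set_scope.
Local Open Scope ring_scope.

(* A symmetrically self-dual space is a nonzero [B : lmodType R] together with
   a symmetric bilinear form [f : {symmetric B}].  In the library
   [{symmetric B}] is [{hermitian B for false & idfun}]; [ssd_symmetric] and
   [ssd_bilinear] check that this is the usual notion. *)

Lemma ssd_symmetric (R : realType) (B : lmodType R) (f : {symmetric B})
  (b c : B) : f b c = f c b.
Proof. by rewrite hermC expr0 mul1r. Qed.

Lemma ssd_bilinear (R : realType) (B : lmodType R) (f : {symmetric B})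
  (a : R) (b c d : B) :
  f (a *: b + c) d = a * f b d + f c d /\
  f d (a *: b + c) = a * f d b + f d c.
Proof. by rewrite linearPl linearPr. Qed.

Definition ssd_q (R : realType) (B : lmodType R) (f : {symmetric B})
  (b : B) : R := 2^-1 * f b b.

(* The multifunctions are [E : {nonneg R} -> set B]: [E] is only defined on
   [0, +oo[, so [in_multifun E e b] reads "[e >= 0] and [b] is in [E e]". *)
Definition in_multifun (R : realType) (B : lmodType R)
  (E : {nonneg R} -> set B) (e : R) (b : B) : Prop :=
  exists e_ge0 : 0 <= e, E (NngNum e_ge0) b.

Definition transportation_formula (R : realType) (B : lmodType R)
    (f : {symmetric B}) (E : {nonneg R} -> set B) : Prop :=
  forall (e1 e2 : {nonneg R}) (b1 b2 : B), E e1 b1 -> E e2 b2 ->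
  forall a1 a2 : R, 0 <= a1 -> 0 <= a2 -> a1 + a2 = 1 ->
  in_multifun E
    (a1 * e1%:num + a2 * e2%:num + a1 * a2 * ssd_q f (b1 - b2))
    (a1 *: b1 + a2 *: b2).

Definition generalized_transportation_formula (R : realType) (B : lmodType R)
    (f : {symmetric B}) (E : {nonneg R} -> set B) : Prop :=
  forall n : nat, (1 <= n)%N ->
  forall (e : 'I_n -> {nonneg R}) (b : 'I_n -> B) (a : 'I_n -> R),
  (forall i, E (e i) (b i)) -> (forall i, 0 <= a i) -> \sum_(i < n) a i = 1 ->
  in_multifun E
    (\sum_(i < n) a i * (e i)%:num
     + \sum_(i < n) a i * ssd_q f (b i - \sum_(j < n) a j *: b j))
    (\sum_(i < n) a i *: b i).

(* [R^o] is [R] as a module over itself, which makes [R^o * B] the product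
   vector space over [R]. *)
Definition multifun_graph (R : realType) (B : lmodType R)
    (E : {nonneg R} -> set B) : set (R^o * B) :=
  [set eb | in_multifun E eb.1 eb.2].

Definition Psi (R : realType) (B : lmodType R) (f : {symmetric B})
    (eb : R^o * B) : R^o * B :=
  (eb.1 + ssd_q f eb.2, eb.2).

(* Main.v *)
Require Import Defs.
From mathcomp Require Import all_boot all_order all_algebra.
From mathcomp Require Import classical_sets reals interval_inference convex.
From mathcomp Require Import ring.

Set Implicit Arguments.
Unset Strict Implicit.
Unset Printing Implicit Defensive.

Import Order.TTheory GRing.Theory Num.Theory.
Local Open Scope classical_set_scope.
Local Open Scope ring_scope.

(** The map [Psi] straightens the transportation formula: it turns the quadratic
correction term into a linear one.  For weights [a i] of sum 1 and
[m = \sum_i a i *: b i], the parallel axis identity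
[\sum_i a i * q (b i - m) = \sum_i a i * q (b i) - q m] ([ssd_q_variance]) says
that the number [e] of the [n]-point formula satisfies
[e + q m = \sum_i a i * (e i + q (b i))].  So [(e + q m, m)] is exactly the
convex combination, with weights [a i], of the points [Psi (e i, b i)].  Since
[Psi] is injective, asking that [e >= 0] and that [m] belong to [E e] is asking
that this convex combination belong to [Psi (G(E))] ([Psi_graphP]).

Hence the [n]-point formula says that [Psi (G(E))] is stable under convex
combinations of [n] points, and the transportation formula, whose correction
term is the case of two points ([ssd_q_variance2]), says that it is stable under
convex combinations of two points, which is convexity.  The equivalence is thus
the classical fact that a convex set contains the convex combinations of any
finite number of its points ([convex_set_sum]). *)

Lemma convex_set2P (R : realType) (M : lmodType R) (A : set M) :
  convex_set A <->
  (forall x y (a1 a2 : R), A x -> A y -> 0 <= a1 -> 0 <= a2 -> a1 + a2 = 1 ->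
    A (a1 *: x + a2 *: y)).
Proof.
split=> [cA x y a1 a2 Ax Ay a1_ge0 a2_ge0 a12 | cA x y t].
  have a1_le1 : a1 <= 1 by rewrite -a12 lerDl.
  have -> : a2 = 1 - a1 by rewrite -a12 addrC addKr.
  by have /set_mem := cA x y (Itv01 a1_ge0 a1_le1) (mem_set Ax) (mem_set Ay).
move=> /set_mem Ax /set_mem Ay; apply/mem_set/cA => //.
- by rewrite subr_ge0.
- by rewrite addrC subrK.
Qed.

(** Split off the first point and renormalize the other weights by their sum
[s]; the renormalization fails only for [s = 0], when the first point has
weight 1. *)
Lemma convex_set_sum (R : realType) (M : lmodType R) (A : set M) (n : nat)
    (x : 'I_n -> M) (a : 'I_n -> R) :
  convex_set A -> (forall i, A (x i)) -> (forall i, 0 <= a i) ->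
  \sum_(i < n) a i = 1 -> A (\sum_(i < n) a i *: x i).
Proof.
move=> /convex_set2P cA; elim: n x a => [|n IHn] x a Ax a_ge0.
  by rewrite big_ord0 => /esym/eqP; rewrite oner_eq0.
rewrite !big_ord_recl; set s := \sum_(i < n) _ => a_sum.
have s_ge0 : 0 <= s by apply: sumr_ge0.
have [s0|s_neq0] := eqVneq s 0.
  have a_eq0 (i : 'I_n) : a (lift ord0 i) = 0.
    by move/eqP: s0; rewrite psumr_eq0 // => /allP/(_ i)/(_ (mem_index_enum _))/eqP.
  rewrite big1 => [|i _]; last by rewrite a_eq0 scale0r.
  by move: a_sum; rewrite s0 !addr0 => ->; rewrite scale1r.
have -> : \sum_(i < n) a (lift ord0 i) *: x (lift ord0 i)
          = s *: \sum_(i < n) (s^-1 * a (lift ord0 i)) *: x (lift ord0 i).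
  rewrite scaler_sumr; apply: eq_bigr => i _.
  by rewrite scalerA mulrA divff // mul1r.
apply: cA => //; apply: IHn => // [i|].
  by rewrite mulr_ge0 ?invr_ge0.
by rewrite -mulr_sumr mulVf.
Qed.

Section QuadraticForm.
Variables (R : realType) (B : lmodType R) (f : {symmetric B}).

Lemma ssd_qB (b c : B) : ssd_q f (b - c) = ssd_q f b - f b c + ssd_q f c.
Proof.
rewrite /ssd_q linearBl !linearBr /= (ssd_symmetric f c b).
by field.
Qed.

(** The parallel axis identity: after expanding each [q (b i - m)], the cross
terms [a i * f (b i) m] add up to [f m m], twice [q m], by linearity. *)
Lemma ssd_q_variance (n : nat) (b : 'I_n -> B) (a : 'I_n -> R) :
  \sum_(i < n) a i = 1 ->
  \sum_(i < n) a i * ssd_q f (b i - \sum_(j < n) a j *: b j)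
  = \sum_(i < n) a i * ssd_q f (b i) - ssd_q f (\sum_(j < n) a j *: b j).
Proof.
move=> a_sum; set m := \sum_(j < n) a j *: b j.
have cross : \sum_(i < n) a i * f (b i) m = f m m.
  rewrite {2}/m linear_sumlz; apply: eq_bigr => i _.
  by rewrite linearZl_LR.
under eq_bigr do rewrite ssd_qB mulrDr mulrBr.
rewrite big_split sumrB -mulr_suml a_sum mul1r cross /= /ssd_q.
by field.
Qed.

(** For two points, [b1 - m] and [b2 - m] are multiples of [b1 - b2], so the
variance is [a1 * a2 * q (b1 - b2)], the correction term of the transportation
formula. *)
Lemma ssd_q_variance2 (a1 a2 : R) (b1 b2 : B) : a1 + a2 = 1 ->
  a1 * a2 * ssd_q f (b1 - b2)
  = a1 * ssd_q f b1 + a2 * ssd_q f b2 - ssd_q f (a1 *: b1 + a2 *: b2).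
Proof.
move=> a12; have -> : a2 = 1 - a1 by rewrite -a12 addrC addKr.
rewrite ssd_qB /ssd_q linearDl !linearDr !linearZl_LR !linearZ /=.
rewrite (ssd_symmetric f b2 b1).
by field.
Qed.

End QuadraticForm.

Section Transportation.
Variables (R : realType) (B : lmodType R) (f : {symmetric B}).
Variable E : {nonneg R} -> set B.

(** The inverse of [Psi] is [(t, b) |-> (t - q b, b)]. *)
Lemma Psi_graphP (t : R^o) (b : B) :
  (Psi f @` multifun_graph E) (t, b) <-> in_multifun E (t - ssd_q f b) b.
Proof.
split=> [[[e c] /= Eec [<- <-]] | Etb]; first by rewrite addrK.
by exists (t - ssd_q f b, b) => //; rewrite /Psi /= subrK.
Qed.

Lemma in_multifunE (e : {nonneg R}) (b : B) : in_multifun E e%:num b <-> E e b.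
Proof.
split=> [[e_ge0]|Eeb]; first by congr (E _ b); apply/val_inj.
by exists (ge0 e); move: Eeb; congr (E _ b); apply/val_inj.
Qed.

Lemma Psi_graph_point (e : {nonneg R}) (b : B) :
  E e b -> (Psi f @` multifun_graph E) (e%:num + ssd_q f b, b).
Proof. by move=> Eeb; apply/Psi_graphP; rewrite addrK; apply/in_multifunE. Qed.

Lemma transportation_convexP :
  transportation_formula f E <-> convex_set (Psi f @` multifun_graph E).
Proof.
split=> [tE|/convex_set2P cE e1 e2 b1 b2 Eb1 Eb2 a1 a2 a1_ge0 a2_ge0 a12].
  apply/convex_set2P => -[t1 b1] [t2 b2] a1 a2.
  move=> /Psi_graphP[e1_ge0 Eb1] /Psi_graphP[e2_ge0 Eb2] a1_ge0 a2_ge0 a12.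
  apply/Psi_graphP; have := tE _ _ _ _ Eb1 Eb2 _ _ a1_ge0 a2_ge0 a12.
  congr (in_multifun E _ _); rewrite ssd_q_variance2 //=.
  (* scaling in [R^o] is multiplication, which [ring] has to see *)
  rewrite /GRing.scale /=; ring.
have /Psi_graphP := cE _ _ _ _ (Psi_graph_point Eb1) (Psi_graph_point Eb2)
  a1_ge0 a2_ge0 a12.
congr (in_multifun E _ _); rewrite ssd_q_variance2 //=.
rewrite /GRing.scale /=; ring.
Qed.

Lemma convex_generalized_transportation :
  convex_set (Psi f @` multifun_graph E) ->
  generalized_transportation_formula f E.
Proof.
move=> cE n _ e b a Eb a_ge0 a_sum.
pose x i : R^o * B := ((e i)%:num + ssd_q f (b i), b i).
have := @convex_set_sum R _ _ n x a cE
  (fun i => Psi_graph_point (Eb i)) a_ge0 a_sum.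
have -> : \sum_(i < n) a i *: x i
    = (\sum_(i < n) a i * ((e i)%:num + ssd_q f (b i)), \sum_(i < n) a i *: b i).
  by elim/big_rec3: _ => // i u v w _ ->.
move=> /Psi_graphP; congr (in_multifun E _ _).
under eq_bigr do rewrite mulrDr.
by rewrite ssd_q_variance // big_split /= addrA.
Qed.

Lemma generalized_transportation_two_points :
  generalized_transportation_formula f E -> transportation_formula f E.
Proof.
move=> gE e1 e2 b1 b2 Eb1 Eb2 a1 a2 a1_ge0 a2_ge0 a12.
pose two T (u v : T) (i : 'I_2) := if i == ord0 then u else v.
have sum_two (V : nmodType) (F : 'I_2 -> V) :
  \sum_(i < 2) F i = F ord0 + F (lift ord0 ord0) by rewrite big_ord_recl big_ord1.
have a_sum : \sum_(i < 2) two R a1 a2 i = 1 by rewrite sum_two.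
have := gE 2 isT (two _ e1 e2) (two _ b1 b2) (two _ a1 a2).
rewrite ssd_q_variance // !sum_two /two /= -ssd_q_variance2 //.
by apply=> // i; case: ifP.
Qed.

End Transportation.

Theorem proposition4 (R : realType) (B : lmodType R)
  (B_nonzero : exists b : B, b != 0) (f : {symmetric B})
  (E : {nonneg R} -> set B) :
  [<-> transportation_formula f E;
       generalized_transportation_formula f E;
       convex_set (Psi f @` multifun_graph E) ].
Proof.
tfae.
- by move/transportation_convexP; apply: convex_generalized_transportation.
- by move/generalized_transportation_two_points/transportation_convexP.
- by move/transportation_convexP.
Qed.
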